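(* Let $N\ge M\ge 2$ be integers, let $\pmb H=[\pmb h_1,\dots,\pmb h_M]\in\mathbb C^{N\times M}$ have nonzero columns, let $\sigma^2>0$, $\pmb y\in\mathbb C^N$, and let $\Xi=\{s_1,\dots,s_{2^m}\}\subset\mathbb C$ be a finite alphabet of size $2^m$. Let $\pmb F_j$ and $\pmb B_j$ $(1\le j\le M)$ be the $2^m\times 2^m$ translation matrices for one complete turn of the forward and backward recursion, as defined in the context, and let the message vectors after $k$ turns be given, up to normalization, by $$\pmb\pi_{j-1\to j}^{(k)}\propto \pmb F_j\,\pmb\pi_{j-1\to j}^{(k-1)}\propto\pmb F_j^k\,\pmb\pi_0,\qquad \pmb\pi_{j+1\to j}^{(k)}\propto \pmb B_j\,\pmb\pi_{j+1\to j}^{(k-1)}\propto\pmb B_j^k\,\pmb\pi_0 .$$ Then for every $j$ and for any initial message $\pmb\pi_0$ (a vector in $\mathbb R^{2^m}$ with nonnegative entries summing to one), as $k\to\infty$ the message $\pmb\pi_{j-1\to j}^{(k)}$ converges, up to a normalization constant, to the eigenvector of $\pmb F_j$ corresponding to its largest eigenvalue. That is, $\pmb F_j^k\pmb\pi_0/\|\pmb F_j^k\pmb\pi_0\|_1$ converges to the eigenvector of $\pmb F_j$ for its largest eigenvalue, scaled so that its entries sum to one. Similarly, $\pmb\pi_{j+1\to j}^{(k)}$ converges (in the same sense) to the eigenvector of $\pmb B_j$ corresponding to its largest eigenvalue.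
   Context: Indices of nodes are taken in $\{1,\dots,M\}$ modulo $M$ (so $M+1$ means $1$ and $0$ means $M$). For $\Phi\subset\{1,\dots,M\}$ put $\pmb K_\Phi=\sigma^2\pmb I+\sum_{k\notin\Phi}\pmb h_k\pmb h_k^H$. For $i\ne j$ define $\pmb w_{j|i}=\pmb K_{\{j,i\}}^{-1}\pmb h_j$, $y_{j|i}=\pmb w_{j|i}^H\pmb y$, $a_{j|i,k}=\pmb w_{j|i}^H\pmb h_k=\pmb h_j^H\pmb K_{\{j,i\}}^{-1}\pmb h_k$ for $k\in\{i,j\}$, and $\sigma_{j|i}^2=\pmb h_j^H\pmb K_{\{j,i\}}^{-1}\pmb h_j=a_{j|i,j}>0$. The translation function is, up to a positive constant not depending on $s,s'$, $$\gamma_{j|i}(s|s')=\frac{1}{\pi\sigma_{j|i}^2}\exp\Big(-\frac{|y_{j|i}-a_{j|i,j}s-a_{j|i,i}s'|^2}{\sigma_{j|i}^2}\Big),\qquad s,s'\in\Xi .$$ $\pmb A_{j|i}$ is the $2^m\times 2^m$ matrix whose $(p,q)$ entry is $\gamma_{j|i}(s_p|s_q)$; all its entries are positive reals. The message recursion is $\pmb\pi_{j\to j\pm1}=\frac{1}{\alpha_{j\pm1}}\pmb A_{j\pm1|j}\,\pmb\pi_{j\mp1\to j}$, with $\alpha_{j\pm 1}$ chosen so that the message vector has unit $L_1$-norm. The matrices for one complete turn are $$\pmb F_j=\pmb A_{j|j-1}\pmb A_{j-1|j-2}\cdots\pmb A_{2|1}\pmb A_{1|M}\pmb A_{M|M-1}\cdots\pmb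 A_{j+1|j},$$ $$\pmb B_j=\pmb A_{j|j+1}\pmb A_{j+1|j+2}\cdots\pmb A_{M-1|M}\pmb A_{M|1}\pmb A_{1|2}\cdots\pmb A_{j-1|j}.$$ $\|\cdot\|_1$ denotes the $L_1$-norm of a vector. *)

(* Defs.v *)
From HB Require Import structures.
From mathcomp Require Import all_boot all_order all_algebra.
From mathcomp Require Import all_classical all_reals all_analysis.
From mathcomp Require Import complex spectral.

Set Implicit Arguments.
Unset Strict Implicit.
Unset Printing Implicit Defensive.

Import Order.TTheory GRing.Theory Num.Theory numFieldNormedType.Exports.

Local Open Scope ring_scope.
Local Open Scope complex_scope.
Local Open Scope sesquilinear_scope.

(* [M ^t*] is the conjugate transpose; sigma2 stands for sigma^2. *)
Definition Kmx (R : realType) (N M : nat) (H : 'M[R[i]]_(N, M)) (sigma2 : R)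
    (Phi : {set 'I_M}) : 'M[R[i]]_N :=
  (sigma2%:C)%:M + \sum_(k | k \notin Phi) col k H *m (col k H)^t*.

(* In every definition below the arguments [j i] are those of the
   subscript j|i, in this order. *)
Definition wvec (R : realType) (N M : nat) (H : 'M[R[i]]_(N, M)) (sigma2 : R)
    (j i : 'I_M) : 'cV[R[i]]_N :=
  invmx (Kmx H sigma2 [set j; i]) *m col j H.

Definition yobs (R : realType) (N M : nat) (H : 'M[R[i]]_(N, M)) (sigma2 : R)
    (y : 'cV[R[i]]_N) (j i : 'I_M) : R[i] :=
  ((wvec H sigma2 j i)^t* *m y) 0 0.

Definition acoef (R : realType) (N M : nat) (H : 'M[R[i]]_(N, M)) (sigma2 : R)
    (j i k : 'I_M) : R[i] :=
  ((wvec H sigma2 j i)^t* *m col k H) 0 0.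

(* sigma_{j|i}^2; the quadratic form is real (and positive when h_j <> 0)
   because K is Hermitian positive definite, so Re loses nothing. *)
Definition svar (R : realType) (N M : nat) (H : 'M[R[i]]_(N, M)) (sigma2 : R)
    (j i : 'I_M) : R :=
  complex.Re
    (((col j H)^t* *m invmx (Kmx H sigma2 [set j; i]) *m col j H) 0 0).

(* The modulus of a complex number lies in R[i], hence the Re. *)
Definition gamma_tr (R : realType) (N M : nat) (H : 'M[R[i]]_(N, M))
    (sigma2 : R) (y : 'cV[R[i]]_N) (j i : 'I_M) (s s' : R[i]) : R :=
  (pi * svar H sigma2 j i)^-1 *
  expR (- (complex.Re `| yobs H sigma2 y j i - acoef H sigma2 j i j * s
                         - acoef H sigma2 j i i * s' | ^+ 2
           / svar H sigma2 j i)).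

Definition Amx (R : realType) (N M : nat) (H : 'M[R[i]]_(N, M)) (sigma2 : R)
    (y : 'cV[R[i]]_N) (m : nat) (s : 'I_(2 ^ m) -> R[i]) (j i : 'I_M) :
    'M[R]_(2 ^ m) :=
  \matrix_(p, q) gamma_tr H sigma2 y j i (s p) (s q).

(* Node indices are 0-based; [ordS] and [ord_pred] are the cyclic successor
   and predecessor on 'I_M.  The products are non-commutative and run from
   left to right: the t-th factor of Fmx is A_{j-t|j-t-1}, so the first one is
   A_{j|j-1} and the last one A_{j+1|j}; symmetrically for Bmx. *)
Definition Fmx (R : realType) (N M : nat) (H : 'M[R[i]]_(N, M)) (sigma2 : R)
    (y : 'cV[R[i]]_N) (m : nat) (s : 'I_(2 ^ m) -> R[i]) (j : 'I_M) :
    'M[R]_(2 ^ m) :=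
  \prod_(t < M) Amx H sigma2 y s (iter t (@ord_pred M) j)
                                 (iter t.+1 (@ord_pred M) j).

Definition Bmx (R : realType) (N M : nat) (H : 'M[R[i]]_(N, M)) (sigma2 : R)
    (y : 'cV[R[i]]_N) (m : nat) (s : 'I_(2 ^ m) -> R[i]) (j : 'I_M) :
    'M[R]_(2 ^ m) :=
  \prod_(t < M) Amx H sigma2 y s (iter t (@ordS M) j) (iter t.+1 (@ordS M) j).

Definition prob_vec (R : realType) (n : nat) (v : 'cV[R]_n) : Prop :=
  (forall p, 0 <= v p 0) /\ \sum_p v p 0 = 1.

Definition l1norm (R : realType) (n : nat) (v : 'cV[R]_n) : R :=
  \sum_p `|v p 0|.

Definition l1normalize (R : realType) (n : nat) (v : 'cV[R]_n) : 'cV[R]_n :=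
  (l1norm v)^-1 *: v.

Definition proportional (R : realType) (n : nat) (u v : 'cV[R]_n) : Prop :=
  exists2 c : R, 0 < c & u = c *: v.

(* [msg k] is the message after k turns with translation matrix A, each turn
   being allowed an arbitrary positive normalization constant. *)
Definition turn_messages (R : realType) (n : nat) (A : 'M[R]_n)
    (pi0 : 'cV[R]_n) (msg : nat -> 'cV[R]_n) : Prop :=
  msg 0%N = pi0 /\ forall k, proportional (msg k.+1) (A *m msg k).

(* Largest in modulus among all the complex eigenvalues of the real matrix A.
   The library's [eigenvalue] uses row eigenvectors, which give the same
   spectrum as column ones. *)
Definition largest_eigenvalue (R : realType) (n : nat) (A : 'M[R]_n)
    (lambda : R) : Prop :=
  eigenvalue A lambda /\
  forall mu : R[i],
    eigenvalue (map_mx (fun x : R => x%:C) A) mu -> `|mu| <= lambda%:C.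

Definition normalized_eigenvector (R : realType) (n : nat) (A : 'M[R]_n)
    (lambda : R) (v : 'cV[R]_n) : Prop :=
  A *m v = lambda *: v /\ \sum_p v p 0 = 1.

(* Main.v *)
(* K is Hermitian positive definite, so sigma_{j|i}^2 > 0, every A_{j|i} is
   entrywise positive, and so are F_j and B_j; what remains is Perron's theorem
   for a positive matrix A.  The columns of A^(k+1), scaled to sum 1, are convex
   combinations of the scaled columns of A^k, with weights bounded below by some
   delta > 0 independent of k.  Hence each row of the scaled A^k oscillates by
   at most (1 - delta)^k, all scaled columns tend to one vector v, and so does
   the normalized A^k pi0 for every probability vector pi0.  Passing to the limit
   in A x_k = c_k x_{k+1} makes v a positive eigenvector. *)

Require Import Defs.
From HB Require Import structures.
From mathcomp Require Import all_boot all_order all_algebra.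
From mathcomp Require Import all_classical all_reals all_analysis.
From mathcomp Require Import complex spectral.
From mathcomp Require Import ring lra.

Set Implicit Arguments.
Unset Strict Implicit.
Unset Printing Implicit Defensive.

Import Order.TTheory GRing.Theory Num.Theory numFieldNormedType.Exports.

Local Open Scope classical_set_scope.
Local Open Scope ring_scope.
Local Open Scope complex_scope.
Local Open Scope sesquilinear_scope.

(** * Positive definiteness of the covariance and positivity of the translation matrices *)

Lemma trmxC_mul (C : numClosedFieldType) (m n p : nat) (A : 'M[C]_(m, n))
  (B : 'M[C]_(n, p)) : (A *m B)^t* = B^t* *m A^t*.
Proof. by rewrite trmx_mul map_mxM. Qed.

Lemma trmxC_mulmxE (C : numClosedFieldType) (n : nat) (x : 'cV[C]_n) :
  (x^t* *m x) 0 0 = \sum_p `|x p 0| ^+ 2.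
Proof.
rewrite mxE; apply: eq_bigr => p _; rewrite !mxE.
by rewrite normCK mulrC.
Qed.

Section Covariance.
Variables (R : realType) (N M : nat) (H : 'M[R[i]]_(N, M)) (sigma2 : R).
Variables (hsigma2 : 0 < sigma2) (Phi : {set 'I_M}).

Lemma Kmx_hermitian : (Kmx H sigma2 Phi)^t* = Kmx H sigma2 Phi.
Proof.
rewrite /Kmx !raddfD /= tr_scalar_mx map_scalar_mx /= conj_Creal; last first.
  by apply/complex_realP; exists sigma2.
congr (_ + _); rewrite raddf_sum raddf_sum /=.
by apply: eq_bigr => k _; rewrite trmxC_mul trmxCK.
Qed.

(** The noise term contributes [sigma2] times |x|^2 > 0, and each rank-one term contributes |h_k^H
    x|^2 >= 0. *)
Lemma Kmx_form_gt0 (x : 'cV[R[i]]_N) : x != 0 ->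
  0 < (x^t* *m Kmx H sigma2 Phi *m x) 0 0.
Proof.
move=> x0; rewrite /Kmx mulmxDr mulmxDl mulmx_sumr mulmx_suml mxE.
apply: ltr_pwDl.
  rewrite mul_mx_scalar -scalemxAl mxE trmxC_mulmxE mulr_gt0 ?ltcR//.
  have [p xp] : exists p, x p 0 != 0.
    apply/existsP; apply: contraNT x0 => /existsPn h; apply/eqP/matrixP => p q.
    by rewrite ord1 mxE; apply/eqP; rewrite -[_ == _]negbK.
  rewrite lt_def sumr_ge0 ?andbT; last by move=> *; rewrite exprn_ge0.
  apply/negP => /eqP /psumr_eq0P h; move/eqP: xp; apply.
  by apply/eqP; rewrite -normr_eq0 -sqrf_eq0 h // => *; rewrite exprn_ge0.
rewrite summxE sumr_ge0// => k _.
have -> : x^t* *m (col k H *m (col k H)^t*) *m x =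
    ((col k H)^t* *m x)^t* *m ((col k H)^t* *m x).
  by rewrite trmxC_mul trmxCK !mulmxA.
by rewrite trmxC_mulmxE sumr_ge0// => *; rewrite exprn_ge0.
Qed.

Lemma Kmx_unit : Kmx H sigma2 Phi \in unitmx.
Proof.
(* [kermx] is a left kernel, so invertibility is tested on the transpose: a kernel row [u] then
   gives K u^T = 0, against positivity of the form. *)
rewrite -unitmx_tr -row_free_unit -kermx_eq0; apply/eqP/row_matrixP => p.
rewrite row0; set u := row p _.
have uK : u *m (Kmx H sigma2 Phi)^T = 0.
  by apply/sub_kermxP; exact: row_sub.
apply/eqP; apply: contraT => u0.
have : u^T != 0 by rewrite trmx_eq0.
move/Kmx_form_gt0; rewrite -mulmxA.
have -> : Kmx H sigma2 Phi *m u^T = 0.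
  by apply: trmx_inj; rewrite trmx_mul trmxK trmx0.
by rewrite mulmx0 mxE ltxx.
Qed.

End Covariance.

(** With x = K^-1 h_j, which is nonzero because h_j is, Hermitian symmetry turns h_j^H K^-1 h_j into
    x^H K x. *)
Lemma svar_gt0 (R : realType) (N M : nat) (H : 'M[R[i]]_(N, M)) (sigma2 : R)
    (j i : 'I_M) : 0 < sigma2 -> col j H != 0 -> 0 < svar H sigma2 j i.
Proof.
move=> hs hj; rewrite /svar; set K := Kmx _ _ _.
have Ku : K \in unitmx by exact: Kmx_unit.
set x := invmx K *m col j H.
have hx : col j H = K *m x by rewrite mulKVmx.
have x0 : x != 0 by apply: contraNneq hj => x0; rewrite hx x0 mulmx0.
rewrite -mulmxA -/x [in col j H]hx trmxC_mul Kmx_hermitian.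
by have := Kmx_form_gt0 H hs [set j; i]%SET x0; rewrite ltcE => /andP[].
Qed.

Lemma Amx_gt0 (R : realType) (N M : nat) (H : 'M[R[i]]_(N, M)) (sigma2 : R)
    (y : 'cV[R[i]]_N) (m : nat) (s : 'I_(2 ^ m) -> R[i]) (j i : 'I_M) p q :
  0 < sigma2 -> col j H != 0 -> 0 < Amx H sigma2 y s j i p q.
Proof.
move=> hs hj; rewrite mxE /gamma_tr mulr_gt0 ?expR_gt0// invr_gt0.
by rewrite mulr_gt0 ?pi_gt0 ?svar_gt0.
Qed.


(** * Positive sums and contraction under repeated averaging *)

Lemma sumr_gt0 (R : numDomainType) (I : finType) (i0 : I) (F : I -> R) :
  (forall i, 0 < F i) -> 0 < \sum_i F i.
Proof.
by move=> hF; rewrite (bigD1 i0)//= ltr_pwDl// sumr_ge0// => *; exact: ltW.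
Qed.

Lemma ler_wmean (R : numDomainType) (I : finType) (i0 : I) (delta : R)
    (w F : I -> R) :
  (forall i, 0 <= w i) -> delta <= w i0 -> (forall i, 0 <= F i) ->
  delta * F i0 <= \sum_i w i * F i.
Proof.
move=> w0 dw F0; rewrite (bigD1 i0)//= ler_wpDr ?ler_wpM2r//.
by rewrite sumr_ge0// => *; rewrite mulr_ge0.
Qed.

Section Averaging.
Variables (R : realType) (n : nat) (i0 : 'I_n) (delta : R).
Variables (f : nat -> 'I_n -> R) (w : nat -> 'I_n -> 'I_n -> R).
Hypothesis delta_gt0 : 0 < delta.
Hypothesis w_ge : forall k l j, delta <= w k l j.
Hypothesis w_sum1 : forall k j, \sum_l w k l j = 1.
Hypothesis f_rec : forall k j, f k.+1 j = \sum_l w k l j * f k l.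
Hypothesis f0_itv : forall j, 0 <= f 0%N j <= 1.

(** An explicit recursion, instead of a minimum over [j], makes the interval width exactly (1 -
    delta)^k; [hi] then obeys the same recursion, started from 1. *)
Let lo := fix lo k : R :=
  if k is k'.+1 then delta * f k' i0 + (1 - delta) * lo k' else 0.
Let hi k := lo k + (1 - delta) ^+ k.

Let w_ge0 k l j : 0 <= w k l j.
Proof. exact: le_trans (ltW delta_gt0) (w_ge k l j). Qed.

(* The weight delta that every average puts on i0 pulls both ends of the
   enclosing interval towards f k i0, shrinking it by the factor 1 - delta. *)
Let f_itv k j : lo k <= f k j <= hi k.
Proof.
elim: k j => [|k IH] j.
  by rewrite /hi /= expr0 add0r.
have avg c : f k.+1 j - c = \sum_l w k l j * (f k l - c).
  under eq_bigr do rewrite mulrBr.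
  by rewrite sumrB -mulr_suml w_sum1 mul1r f_rec.
have h1 : delta * (f k i0 - lo k) <= \sum_l w k l j * (f k l - lo k).
  apply: (@ler_wmean _ _ i0 _ (fun l => w k l j) (fun l => f k l - lo k)) => // l.
  by rewrite subr_ge0; case/andP: (IH l).
have h2 : delta * (hi k - f k i0) <= \sum_l w k l j * (hi k - f k l).
  apply: (@ler_wmean _ _ i0 _ (fun l => w k l j) (fun l => hi k - f k l)) => // l.
  by rewrite subr_ge0; case/andP: (IH l).
have e2 : \sum_l w k l j * (hi k - f k l) = hi k - f k.+1 j.
  by rewrite -[RHS]opprB avg -sumrN; apply: eq_bigr => l _; ring.
rewrite -avg in h1; rewrite e2 in h2.
by rewrite /hi /= exprS; rewrite /hi in h2; apply/andP; split; lra.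
Qed.

Let lo_nondecreasing : nondecreasing_seq lo.
Proof.
apply/nondecreasing_seqP => k /=; have /andP[+ _] := f_itv k i0.
by rewrite -subr_ge0 => /(mulr_ge0 (ltW delta_gt0)); lra.
Qed.

Let hi_nonincreasing : nonincreasing_seq hi.
Proof.
apply/nonincreasing_seqP => k; have /andP[_] := f_itv k i0.
rewrite -subr_ge0 => /(mulr_ge0 (ltW delta_gt0)).
by rewrite /hi /= exprS; lra.
Qed.

Let lo_le_hi m k : lo m <= hi k.
Proof.
apply: (@le_trans _ _ (lo (maxn m k))).
  by apply: lo_nondecreasing; exact: leq_maxl.
apply: (@le_trans _ _ (hi (maxn m k))).
  by case/andP: (f_itv (maxn m k) i0) => /le_trans; apply.
by apply: hi_nonincreasing; exact: leq_maxr.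
Qed.

(** The limit of [lo] lies in every [lo k, hi k], as does every convex combination of the values
    [f k l], so the two differ by at most the width. Leaving the weights [t] arbitrary lets one [c]
    serve all initial vectors. *)
Lemma averaging_limit : exists c, forall k (t : 'I_n -> R),
  (forall l, 0 <= t l) -> \sum_l t l = 1 ->
  `|\sum_l t l * f k l - c| <= (1 - delta) ^+ k.
Proof.
have lo_cvg : cvgn lo.
  apply: nondecreasing_is_cvgn => //.
  by exists (hi 0%N) => _ [m _ <-].
exists (limn lo) => k t t_ge0 t_sum1.
have h1 : lo k <= limn lo by exact: nondecreasing_cvgn_le.
have h2 : limn lo <= hi k by apply: limr_le => //; near=> m.
have h3 : lo k <= \sum_l t l * f k l.
  rewrite -[lo k]mul1r -t_sum1 mulr_suml ler_sum// => l _.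
  by rewrite ler_wpM2l//; case/andP: (f_itv k l).
have h4 : \sum_l t l * f k l <= hi k.
  rewrite -[hi k]mul1r -t_sum1 mulr_suml ler_sum// => l _.
  by rewrite ler_wpM2l//; case/andP: (f_itv k l).
by rewrite /hi in h2 h4; rewrite ler_norml; apply/andP; split; lra.
Unshelve. all: by end_near. Qed.

End Averaging.

(** * Perron's theorem for an entrywise positive matrix *)

Section Perron.
Variables (R : realType) (n : nat) (A : 'M[R]_n) (i0 : 'I_n).
Hypothesis A_gt0 : forall p q, 0 < A p q.

Let colsum k j : R := \sum_p (A ^+ k) p j.

Let expA_ge0 k p q : 0 <= (A ^+ k) p q.
Proof.
elim: k p q => [|k IH] p q; first by rewrite expr0 mxE; case: (p == q).
by rewrite exprSr -mulmxE mxE sumr_ge0// => l _; rewrite mulr_ge0// ltW.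
Qed.

Let colsumS k j : colsum k.+1 j = \sum_l colsum k l * A l j.
Proof.
rewrite /colsum; under [RHS]eq_bigr do rewrite mulr_suml.
rewrite [RHS]exchange_big; apply: eq_bigr => p _.
by rewrite exprSr -mulmxE mxE.
Qed.

Let colsum_gt0 k j : 0 < colsum k j.
Proof.
elim: k j => [|k IH] j; last first.
  by rewrite colsumS (sumr_gt0 i0)// => l; rewrite mulr_gt0.
rewrite /colsum (bigD1 j)//= expr0 mxE eqxx ltr_pwDl// sumr_ge0// => p _.
by rewrite mxE; case: (p == j).
Qed.

(* From one turn on, the column sums of A ^+ k are within a bounded ratio of
   each other, hence the uniform lower bound on the averaging weights. *)
Let colsum_ratio : exists2 delta, 0 < delta &
  forall k l j, delta * colsum k.+1 j <= colsum k l * A l j.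
Proof.
(* Explicit bounds a <= A p q <= b. The summand 1 also ensures a <= 1 <= b, which covers k = 0,
   where all column sums are 1. *)
pose a := (1 + \sum_p \sum_q (A p q)^-1)^-1.
pose b := 1 + \sum_p \sum_q A p q.
have sum2_ge (F : 'I_n -> 'I_n -> R) p q : (forall p q, 0 < F p q) ->
    F p q <= 1 + \sum_p \sum_q F p q /\ 1 <= 1 + \sum_p \sum_q F p q.
  move=> F0; have F1 r : 0 <= \sum_q F r q by rewrite sumr_ge0// => *; exact: ltW.
  split; last by rewrite lerDl sumr_ge0.
  rewrite ler_wpDl// (bigD1 p)//= ler_wpDr ?sumr_ge0// (bigD1 q)//= ler_wpDr//.
  by rewrite sumr_ge0// => *; exact: ltW.
have invA_gt0 p q : 0 < (A p q)^-1 by rewrite invr_gt0.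
have a_le p q : a <= A p q.
  have [h _] := sum2_ge (fun p q => (A p q)^-1) p q invA_gt0.
  by rewrite -[leRHS]invrK /a lef_pV2// posrE//; exact: lt_le_trans h.
have a_le1 : a <= 1.
  have [_ h] := sum2_ge (fun p q => (A p q)^-1) i0 i0 invA_gt0.
  by rewrite invf_le1//; exact: lt_le_trans h.
have a_gt0 : 0 < a.
  have [_ h] := sum2_ge (fun p q => (A p q)^-1) i0 i0 invA_gt0.
  by rewrite invr_gt0; exact: lt_le_trans h.
have b_ge p q : A p q <= b by have [] := sum2_ge _ p q A_gt0.
have b_ge1 : 1 <= b by have [] := sum2_ge _ i0 i0 A_gt0.
have b_gt0 : 0 < b by exact: lt_le_trans b_ge1.
(* [S] depends on [k] only: 1 for k = 0, and otherwise the sum of all entries of the preceding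
   power. *)
have bounds k : exists2 S, 0 < S & forall l, a * S <= colsum k l <= S * b.
  case: k => [|k].
    exists 1 => // l; have -> : colsum 0 l = 1.
      rewrite /colsum (bigD1 l)//= expr0 mxE eqxx big1 ?addr0// => p /negPf pl.
      by rewrite mxE pl.
    by rewrite mulr1 mul1r a_le1.
  exists (\sum_q colsum k q) => [|l]; first exact: sumr_gt0.
  rewrite colsumS mulr_sumr mulr_suml !ler_sum// => q _.
    by rewrite ler_wpM2l// ltW.
  by rewrite mulrC ler_wpM2l// ltW.
have n_gt0 : 0 < n%:R :> R by rewrite ltr0n (leq_ltn_trans _ (ltn_ord i0)).
(* Quotient of the lower bound a^2 S for [colsum k l * A l j] and the upper bound n b^2 S for
   [colsum k.+1 j]; [S] cancels. *)
exists (a ^+ 2 / (n%:R * b ^+ 2)) => [|k l j].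
  by rewrite divr_gt0 ?mulr_gt0 ?exprn_gt0.
have [S S_gt0 hS] := bounds k.
have up : colsum k.+1 j <= n%:R * b ^+ 2 * S.
  have -> : n%:R * b ^+ 2 * S = \sum_(l < n) S * b * b.
    by rewrite sumr_const card_ord -mulr_natl; ring.
  rewrite colsumS ler_sum// => q _.
  by rewrite ler_pM// ?(ltW (colsum_gt0 _ _)) ?(ltW (A_gt0 _ _))//; case/andP: (hS q).
have low : a ^+ 2 * S <= colsum k l * A l j.
  have -> : a ^+ 2 * S = a * S * a by ring.
  by rewrite ler_pM ?mulr_ge0 ?(ltW a_gt0) ?(ltW S_gt0)//; case/andP: (hS l).
apply: le_trans low; rewrite mulrAC ler_pdivrMr ?mulr_gt0 ?exprn_gt0//.
have -> : a ^+ 2 * S * (n%:R * b ^+ 2) = a ^+ 2 * (n%:R * b ^+ 2 * S) by ring.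
by rewrite ler_wpM2l ?exprn_ge0 ?(ltW a_gt0).
Qed.

Let total k (x : 'cV[R]_n) : R := \sum_p (A ^+ k *m x) p 0.

Let totalE k x : total k x = \sum_l colsum k l * x l 0.
Proof.
rewrite /total /colsum; under [RHS]eq_bigr do rewrite mulr_suml.
by rewrite [RHS]exchange_big; apply: eq_bigr => p _; rewrite mxE.
Qed.

Let total_gt0 k x : prob_vec x -> 0 < total k x.
Proof.
move=> [x0 x1]; rewrite totalE.
have ge0 l : 0 <= colsum k l * x l 0 by rewrite mulr_ge0// ltW.
rewrite lt_def sumr_ge0// andbT; apply/eqP => /psumr_eq0P h.
have /eqP := oner_neq0 R; apply; rewrite -x1 big1// => l _.
by have /eqP := h (fun l _ => ge0 l) l isT; rewrite mulf_eq0 gt_eqF//= => /eqP.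
Qed.

Let l1normalizeE k x p : prob_vec x ->
  l1normalize (A ^+ k *m x) p 0 = (total k x)^-1 * (A ^+ k *m x) p 0.
Proof.
move=> [x0 _]; rewrite mxE; congr (_^-1 * _); apply: eq_bigr => q _.
by rewrite ger0_norm// mxE sumr_ge0// => l _; rewrite mulr_ge0.
Qed.

(** The normalized iterate is a convex combination of the scaled columns of A^k, so the averaging
    bound applies to it with [v] and the rate independent of [x]. *)
Let iterates_contract : exists (delta : R) (v : 'cV[R]_n), [/\ 0 < delta,
  delta <= 1 & forall k x p, prob_vec x ->
  `|l1normalize (A ^+ k *m x) p 0 - v p 0| <= (1 - delta) ^+ k].
Proof.
have [delta delta_gt0 hdelta] := colsum_ratio.
pose w k l j := colsum k l * A l j / colsum k.+1 j.
have w_ge k l j : delta <= w k l j by rewrite /w ler_pdivlMr.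
have w_sum1 k j : \sum_l w k l j = 1.
  by rewrite /w -mulr_suml -colsumS divff// gt_eqF.
have delta_le1 : delta <= 1.
  rewrite -(w_sum1 0%N i0) (bigD1 i0)//= ler_wpDr// sumr_ge0// => l _.
  exact: le_trans (ltW _) (w_ge _ _ _).
(* Row [p] of A^k after each column is scaled to sum 1; averaging is applied to each row
   separately. *)
pose f p k j := (A ^+ k) p j / colsum k j.
have f_rec p k j : f p k.+1 j = \sum_l w k l j * f p k l.
  rewrite /f exprSr -mulmxE mxE mulr_suml; apply: eq_bigr => l _.
  by rewrite /w; field; rewrite !gt_eqF.
have f_itv p j : 0 <= f p 0%N j <= 1.
  rewrite /f divr_ge0 ?(ltW (colsum_gt0 _ _))//= ler_pdivrMr// mul1r /colsum.
  by rewrite (bigD1 p)//= ler_wpDr// sumr_ge0.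
have /= lim p := averaging_limit i0 delta_gt0 w_ge w_sum1
  (f_rec p) (f_itv p).
pose c p := sval (cid (lim p)).
exists delta, (\col_p c p); split => // k x p hx.
(* Weight of scaled column [l] in the normalized iterate: the initial weight [x l 0] times the
   column sum removed by scaling. *)
pose t l := colsum k l * x l 0 / total k x.
have -> : l1normalize (A ^+ k *m x) p 0 = \sum_l t l * f p k l.
  rewrite l1normalizeE// mxE mulr_sumr; apply: eq_bigr => l _.
  by rewrite /t /f; field; rewrite !gt_eqF// total_gt0.
rewrite [X in _ - X]mxE; apply: (svalP (cid (lim p)) k t) => [l|].
  rewrite divr_ge0 ?(ltW (total_gt0 _ _))// mulr_ge0 ?(ltW (colsum_gt0 _ _))//.
  by case: hx.
by rewrite -mulr_suml -totalE divff// gt_eqF// total_gt0.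
Qed.


Let l1normalize_prob k x : prob_vec x -> prob_vec (l1normalize (A ^+ k *m x)).
Proof.
move=> hx; split=> [p|].
  rewrite l1normalizeE// mulr_ge0 ?invr_ge0 ?(ltW (total_gt0 _ _))//.
  by rewrite mxE sumr_ge0// => l _; rewrite mulr_ge0//; case: hx.
under eq_bigr do rewrite l1normalizeE//.
by rewrite -mulr_sumr mulVf// gt_eqF// total_gt0.
Qed.

Lemma iterates_cvg : exists v : 'cV[R]_n, forall x, prob_vec x ->
  (fun k => l1normalize (A ^+ k *m x)) @ \oo --> v.
Proof.
have [delta [v [d0 d1 hv]]] := iterates_contract; exists v => x hx.
have geo : (GRing.exp (1 - delta) : R ^nat) @ \oo --> 0.
  by apply: cvg_expr; rewrite ger0_norm; lra.
apply/cvg_ballP => e e0; move/cvgrPdist_lt: geo => /(_ e e0).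
apply: filterS => k; rewrite sub0r normrN => hk.
split=> // p q; rewrite ord1 /ball /= distrC.
by apply: le_lt_trans (hv k x p hx) _; apply: le_lt_trans hk; exact: ler_norm.
Qed.

Lemma perron_vector : exists (lambda : R) (v : 'cV[R]_n),
  [/\ forall p, 0 < v p 0, \sum_p v p 0 = 1, A *m v = lambda *: v &
      forall x, prob_vec x ->
        (fun k => l1normalize (A ^+ k *m x)) @ \oo --> v].
Proof.
have [v hv] := iterates_cvg.
(* Any probability vector would do here, since the limit [v] is common to all of them. *)
pose x : 'cV[R]_n := delta_mx i0 0.
have hx : prob_vec x.
  split=> [p|]; first by rewrite mxE; case: (_ && _).
  rewrite (bigD1 i0)//= mxE !eqxx big1 ?addr0// => p /negPf pi.
  by rewrite mxE pi.
pose u k := l1normalize (A ^+ k *m x).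
have u_cvg p : (fun k => u k p 0) @ \oo --> v p 0.
  exact: (cvg_comp _ _ (hv x hx) (@coord_continuous _ _ _ p 0 v)).
have sum_cvg (F : nat -> 'I_n -> R) G :
    (forall p, (fun k => F k p) @ \oo --> G p) ->
    (fun k => \sum_p F k p) @ \oo --> \sum_p G p.
  by move=> FG; apply: cvg_big => //; exact: add_continuous.
have Au_cvg p : (fun k => (A *m u k) p 0) @ \oo --> (A *m v) p 0.
  rewrite mxE; under eq_cvg do rewrite mxE.
  by apply: sum_cvg => q; apply: cvgM => //; exact: cvg_cst.
have v_ge0 p : 0 <= v p 0.
  rewrite -(cvg_lim _ (u_cvg p))//; apply: limr_ge; first exact: cvgP (u_cvg p).
  by near=> k; case: (l1normalize_prob k hx).
have v_sum1 : \sum_p v p 0 = 1.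
  have := sum_cvg _ _ u_cvg.
  under eq_cvg do rewrite (proj2 (l1normalize_prob _ hx)).
  by move/cvg_lim => <-//; rewrite lim_cst.
(* Forced by A v = lambda v, because the entries of [v] sum to 1. *)
pose lambda := \sum_p (A *m v) p 0.
have Av : A *m v = lambda *: v.
  apply/matrixP => p q; rewrite ord1 [RHS]mxE.
  (* A u_k equals the sum of its entries times u_(k+1). Both sides converge, to A v and lambda v,
     and limits are unique. *)
  have h : (fun k => (\sum_p (A *m u k) p 0) * u k.+1 p 0) @ \oo -->
      lambda * v p 0.
    apply: cvgM; first exact: sum_cvg.
    by rewrite (cvg_shiftS (fun k => u k p 0)); exact: u_cvg.
  apply: (cvg_unique _ (Au_cvg p)) => //.
  apply: cvg_trans h; apply: near_eq_cvg; near=> k.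
  have Auk r : (A *m u k) r 0 = (total k x)^-1 * (A ^+ k.+1 *m x) r 0.
    rewrite exprS -mulmxE -mulmxA mxE [in RHS]mxE mulr_sumr.
    by apply: eq_bigr => l _; rewrite /u l1normalizeE// mulrCA.
  under eq_bigr do rewrite Auk.
  rewrite Auk /u l1normalizeE// -mulr_sumr -/(total k.+1 x).
  by field; rewrite !gt_eqF ?total_gt0.
(* A nonnegative nonzero [v] has a positive image under [A]; since this image is lambda v, no entry
   of [v] can vanish. *)
have Av_gt0 p : 0 < (A *m v) p 0.
  have ge0 l : 0 <= A p l * v l 0 by rewrite mulr_ge0// ltW.
  rewrite mxE lt_def sumr_ge0// andbT; apply/eqP => /psumr_eq0P h.
  have /eqP := oner_neq0 R; apply; rewrite -v_sum1 big1// => l _.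
  by have /eqP := h (fun l _ => ge0 l) l isT; rewrite mulf_eq0 gt_eqF//= => /eqP.
exists lambda, v; split => // p.
rewrite lt_def v_ge0 andbT; apply/eqP => vp0.
by have := Av_gt0 p; rewrite Av mxE vp0 mulr0 ltxx.
Unshelve. all: by end_near. Qed.


(** Subtracting from [w] the multiple of [v] given by the least ratio w_p / v_p leaves a nonnegative
    vector, still in the eigenspace, with a zero entry at [p0]. Row [p0] of the eigenvector
    equation, with [A] positive, makes it vanish entirely; the unit sums then fix the multiple as
    1. *)
Lemma perron_unique (lambda : R) (v w : 'cV[R]_n) : (forall p, 0 < v p 0) ->
  \sum_p v p 0 = 1 -> A *m v = lambda *: v ->
  normalized_eigenvector A lambda w -> v = w.
Proof.
move=> v_gt0 v_sum1 Av [Aw w_sum1].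
pose r p := w p 0 / v p 0.
case: (@arg_minP _ R _ i0 xpredT r isT) => p0 _ r_min.
pose u := w - r p0 *: v.
have Au : A *m u = lambda *: u.
  by rewrite /u mulmxBr -scalemxAr Av Aw scalerBr !scalerA mulrC.
have u_ge0 p : 0 <= u p 0.
  by rewrite !mxE subr_ge0 -ler_pdivlMr//; exact: r_min.
have u_p0 : u p0 0 = 0 by rewrite !mxE /r divfK ?subrr// gt_eqF.
have u0 : u = 0.
  apply/matrixP => l q; rewrite ord1 [RHS]mxE.
  have ge0 q' : 0 <= A p0 q' * u q' 0 by rewrite mulr_ge0// ltW.
  have := congr1 (fun M : 'cV_n => M p0 0) Au.
  rewrite mxE [RHS]mxE u_p0 mulr0 => /psumr_eq0P h.
  by have /eqP := h (fun l _ => ge0 l) l isT; rewrite mulf_eq0 gt_eqF//= => /eqP.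
have wE : w = r p0 *: v by apply/eqP; rewrite -subr_eq0; apply/eqP.
suff r1 : r p0 = 1 by rewrite wE r1 scale1r.
rewrite -w_sum1 wE -[LHS]mulr1 -v_sum1 mulr_sumr.
by apply: eq_bigr => p _; rewrite mxE.
Qed.

(* A positive column eigenvector v weighs the moduli of the entries of a row
   eigenvector z for mu:
   |mu| sum_q |z_q| v_q <= sum_p |z_p| (A v)_p = lambda sum_p |z_p| v_p. *)
Lemma perron_largest (lambda : R) (v : 'cV[R]_n) : (forall p, 0 < v p 0) ->
  A *m v = lambda *: v -> largest_eigenvalue A lambda.
Proof.
move=> v_gt0 Av; split.
  (* [eigenvalue] concerns row vectors; singularity of A - lambda is passed to its transpose, whose
     left kernel contains [v^T]. *)
  rewrite /eigenvalue /eigenspace kermx_eq0 row_free_unit -unitmx_tr.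
  rewrite -row_free_unit -kermx_eq0; apply/rowV0Pn; exists v^T.
    apply/sub_kermxP; rewrite -trmx_mul mulmxBl Av mul_scalar_mx subrr.
    exact: trmx0.
  rewrite trmx_eq0; apply/eqP => v0; have := v_gt0 i0.
  by rewrite v0 mxE ltxx.
move=> mu /eigenvalueP[z zA z0].
pose S := \sum_q `|z 0 q| * (v q 0)%:C%C.
have vC_gt0 q : 0 < (v q 0)%:C%C by rewrite ltcR.
have S_gt0 : 0 < S.
  have ge0 q : 0 <= `|z 0 q| * (v q 0)%:C%C by rewrite mulr_ge0// ltW.
  rewrite lt_def sumr_ge0// andbT; apply: contraNneq z0 => /psumr_eq0P h.
  apply/eqP/matrixP => p q; rewrite ord1 mxE; apply/eqP.
  have /eqP := h (fun q _ => ge0 q) q isT.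
  by rewrite mulf_eq0 (gt_eqF (vC_gt0 q)) orbF normr_eq0.
rewrite -(ler_pM2r S_gt0) /S mulr_sumr.
have step q : `|mu| * (`|z 0 q| * (v q 0)%:C%C) <=
    \sum_p `|z 0 p| * (A p q * v q 0)%:C%C.
  rewrite mulrA -normrM.
  have -> : mu * z 0 q = \sum_p z 0 p * (A p q)%:C%C.
    have := congr1 (fun M : 'rV_n => M 0 q) zA; rewrite mxE [RHS]mxE => <-.
    by apply: eq_bigr => p _; rewrite mxE.
  apply: (le_trans (ler_wpM2r (ltW (vC_gt0 q)) (ler_norm_sum _ _ _))).
  rewrite mulr_suml ler_sum// => p _; rewrite normrM rmorphM mulrA.
  by rewrite [`|(A p q)%:C%C|]ger0_norm// lecR ltW.
apply: (le_trans (ler_sum _ (fun q _ => step q))).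
rewrite exchange_big mulr_sumr ler_sum//= => p _.
have Avp : \sum_q A p q * v q 0 = lambda * v p 0.
  by have := congr1 (fun M : 'cV_n => M p 0) Av; rewrite mxE [RHS]mxE.
by rewrite -mulr_sumr -rmorph_sum Avp rmorphM /= [leRHS]mulrCA.
Qed.

End Perron.

(** * From powers of a positive matrix to normalized messages *)

Lemma l1normalizeZ (R : realType) (n : nat) (c : R) (v : 'cV[R]_n) : 0 < c ->
  l1normalize (c *: v) = l1normalize v.
Proof.
move=> c_gt0; rewrite /l1normalize scalerA.
have -> : l1norm (c *: v) = c * l1norm v.
  rewrite /l1norm mulr_sumr; apply: eq_bigr => p _.
  by rewrite mxE normrM gtr0_norm.
by rewrite invfM mulrAC mulVf ?mul1r// gt_eqF.
Qed.

Lemma turn_messages_iter (R : realType) (n : nat) (A : 'M[R]_n)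
    (pi0 : 'cV[R]_n) (msg : nat -> 'cV[R]_n) : turn_messages A pi0 msg ->
  forall k, proportional (msg k) (A ^+ k *m pi0).
Proof.
move=> [msg0 msgS]; elim=> [|k [c c_gt0 IH]].
  by exists 1; rewrite ?ltr01// scale1r expr0 -[1]/(1%:M) mul1mx.
have [d d_gt0 ->] := msgS k; exists (d * c); first exact: mulr_gt0.
by rewrite IH -scalemxAr scalerA exprS -mulmxE mulmxA.
Qed.

(** Stated for an arbitrary positive matrix so that it serves the forward and the backward turn
    alike. The constants of the turns accumulate to one positive factor, which normalization
    removes. *)
Lemma positive_turn_convergence (R : realType) (n : nat) (A : 'M[R]_n) :
  (0 < n)%N -> (forall p q, 0 < A p q) ->
  exists (lambda : R) (v : 'cV[R]_n),
    [/\ largest_eigenvalue A lambda,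
        unique (normalized_eigenvector A lambda) v &
        forall pi0 : 'cV[R]_n, prob_vec pi0 ->
          (forall msg : nat -> 'cV[R]_n, turn_messages A pi0 msg ->
             (fun k : nat => l1normalize (msg k)) @ \oo --> v) /\
          (fun k : nat => l1normalize (A ^+ k *m pi0)) @ \oo --> v].
Proof.
move=> n_gt0 A_gt0; pose i0 := Ordinal n_gt0.
have [lambda [v [v_gt0 v_sum1 Av v_cvg]]] := perron_vector i0 A_gt0.
exists lambda, v; split; first exact: perron_largest Av.
  by split=> // w; exact: perron_unique Av.
move=> pi0 hpi0; split=> [msg /turn_messages_iter hmsg|]; last exact: v_cvg.
have -> : (fun k => l1normalize (msg k)) = fun k => l1normalize (A ^+ k *m pi0).
  by apply/funext => k; have [c c_gt0 ->] := hmsg k; rewrite l1normalizeZ.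
exact: v_cvg.
Qed.

(** The induction starts at one factor: the empty product is the identity, whose off-diagonal
    entries are 0. *)
Lemma prodmx_gt0 (R : realType) (n M : nat) (A : 'I_M -> 'M[R]_n) :
  (0 < M)%N -> (forall t p q, 0 < A t p q) ->
  forall p q, 0 < (\prod_t A t) p q.
Proof.
case: M A => // M A _; elim: M A => [|M IH] A A_gt0 p q.
  by rewrite big_ord1.
rewrite big_ord_recl -mulmxE mxE (sumr_gt0 p)// => l.
by rewrite mulr_gt0// IH.
Qed.

Theorem theorem1 (R : realType) (N M m : nat) (H : 'M[R[i]]_(N, M))
    (sigma2 : R) (y : 'cV[R[i]]_N) (s : 'I_(2 ^ m) -> R[i])
    (hM : (2 <= M)%N) (hNM : (M <= N)%N)
    (hH : forall k : 'I_M, col k H != 0)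
    (hsigma2 : 0 < sigma2) (hs : injective s) (j : 'I_M) :
  (exists (lambda : R) (v : 'cV[R]_(2 ^ m)),
    [/\ largest_eigenvalue (Fmx H sigma2 y s j) lambda,
        unique (normalized_eigenvector (Fmx H sigma2 y s j) lambda) v &
        forall pi0 : 'cV[R]_(2 ^ m), prob_vec pi0 ->
          (forall msg : nat -> 'cV[R]_(2 ^ m),
             turn_messages (Fmx H sigma2 y s j) pi0 msg ->
             (fun k : nat => l1normalize (msg k)) @ \oo --> v) /\
          (fun k : nat => l1normalize ((Fmx H sigma2 y s j) ^+ k *m pi0))
             @ \oo --> v]) /\
  (exists (lambda : R) (v : 'cV[R]_(2 ^ m)),
    [/\ largest_eigenvalue (Bmx H sigma2 y s j) lambda,
        unique (normalized_eigenvector (Bmx H sigma2 y s j) lambda) v &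
        forall pi0 : 'cV[R]_(2 ^ m), prob_vec pi0 ->
          (forall msg : nat -> 'cV[R]_(2 ^ m),
             turn_messages (Bmx H sigma2 y s j) pi0 msg ->
             (fun k : nat => l1normalize (msg k)) @ \oo --> v) /\
          (fun k : nat => l1normalize ((Bmx H sigma2 y s j) ^+ k *m pi0))
             @ \oo --> v]).
Proof.
have n_gt0 : (0 < 2 ^ m)%N by rewrite expn_gt0.
have M_gt0 : (0 < M)%N by exact: ltnW.
have A_gt0 i k p q : 0 < Amx H sigma2 y s i k p q by exact: Amx_gt0.
by split; apply: positive_turn_convergence => // p q; exact: prodmx_gt0.
Qed.
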